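(* Let $n,d\in\mathbb N$. Let $(A,B,E,\mathrm{tr}_A)$ be a right Gabor bimodule, and assume in addition that $B$ is unital. Let $\mathrm{tr}_B$ be the trace on $B$ induced by $\mathrm{tr}_A$. If $g\in M_{n,d}(E)$ is such that $\Phi_g\Phi_g^*:M_n(A)\to M_n(A)$ is an isomorphism, where $\Phi_g:M_{n,d}(E)\to M_n(A)$, $\Phi_g f={}_\bullet[f,g]$, then $$d\,\mathrm{tr}_B(1_B)\ge n\,\mathrm{tr}_A(1_A).$$
   Context: An $A$-$B$-equivalence bimodule is an $A$-$B$-bimodule $E$ that is a left Hilbert $A$-module with inner product ${}_\bullet\langle\cdot,\cdot\rangle$ (linear in the first variable) and a right Hilbert $B$-module with inner product $\langle\cdot,\cdot\rangle_\bullet$ (linear in the second variable) such that: (i) the linear span of $\{{}_\bullet\langle f,g\rangle\}$ is dense in $A$ and that of $\{\langle f,g\rangle_\bullet\}$ is dense in $B$; (ii) $\langle af,g\rangle_\bullet=\langle f,a^*g\rangle_\bullet$ and ${}_\bullet\langle fb,g\rangle={}_\bullet\langle f,gb^*\rangle$; (iii) ${}_\bullet\langle f,g\rangle h=f\langle g,h\rangle_\bullet$, for all $f,g,h\in E$, $a\in A$, $b\in B$. A right Gabor bimodule is a quadruple $(A,B,E,\mathrm{tr}_A)$ where $A,B$ are $C^*$-algebras, $A$ is unital, $\mathrm{tr}_A$ is a faithful finite (positive) trace on $A$, and $E$ is an $A$-$B$-equivalence bimodule. The induced trace $\mathrm{tr}_B$ is the unique lower semicontinuous trace on $B$ with $\mathrm{tr}_A({}_\bullet\langle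 f,g\rangle)=\mathrm{tr}_B(\langle g,f\rangle_\bullet)$ for all $f,g\in E$; it is finite when $B$ is unital. No normalization of the traces is assumed. $M_{n,d}(E)$ is the space of $n\times d$ matrices over $E$, with rows indexed by $\mathbb Z_n=\mathbb Z/n\mathbb Z$ and columns by $\mathbb Z_d$. It is an $M_n(A)$-$M_d(B)$-equivalence bimodule for the actions $(af)_{i,j}=\sum_{k\in\mathbb Z_n}a_{i,k}f_{k,j}$, $(fb)_{i,j}=\sum_{k\in\mathbb Z_d}f_{i,k}b_{k,j}$ and inner products ${}_\bullet[f,g]_{i,j}=\sum_{k\in\mathbb Z_d}{}_\bullet\langle f_{i,k},g_{j,k}\rangle$ (in $M_n(A)$) and $([f,g]_\bullet)_{i,j}=\sum_{k\in\mathbb Z_n}\langle f_{k,i},g_{k,j}\rangle_\bullet$ (in $M_d(B)$). The adjoint of $\Phi_g$ is $\Phi_g^*:M_n(A)\to M_{n,d}(E)$, $a\mapsto ag$. *)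

(* Defs.v *)
From HB Require Import structures.
From mathcomp Require Import all_boot all_order all_algebra.
From mathcomp Require Import complex.
From mathcomp Require Import boolp classical_sets reals topology normedtype.

Set Implicit Arguments.
Unset Strict Implicit.
Unset Printing Implicit Defensive.

Import Order.TTheory GRing.Theory Num.Theory.

Local Open Scope classical_set_scope.
Local Open Scope ring_scope.

Reserved Notation "a ** b" (at level 40, left associativity).

(* C*-algebras need not be unital, so the product is an explicit operation.
   Norms of elements are the nonnegative real elements of [R[i]]. *)
HB.mixin Record isCStarAlgebra (R : realType) A
    of CompleteNormedModule R[i] A := {
  cmul : A -> A -> A ;
  star : A -> A ;
  cmulA : associative cmul ;
  cmulDl : left_distributive cmul +%R ;
  cmulDr : right_distributive cmul +%R ;
  cmulZl : forall (c : R[i]) (a b : A), cmul (c *: a) b = c *: cmul a b ;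
  cmulZr : forall (c : R[i]) (a b : A), cmul a (c *: b) = c *: cmul a b ;
  starK : involutive star ;
  starD : {morph star : a b / a + b} ;
  starZ : forall (c : R[i]) (a : A), star (c *: a) = c^* *: star a ;
  starM : forall a b : A, star (cmul a b) = cmul (star b) (star a) ;
  cmul_norm : forall a b : A, `|cmul a b| <= `|a| * `|b| ;
  cstar_identity : forall a : A, `|cmul (star a) a| = `|a| ^+ 2
}.

#[short(type="cstarAlgType")]
HB.structure Definition CStarAlgebra (R : realType) :=
  { A of CompleteNormedModule R[i] A & isCStarAlgebra R A }.

Notation "a ** b" := (cmul a b) : ring_scope.

Definition is_unit_element (R : realType) (A : cstarAlgType R) (e : A) : Prop :=
  forall a : A, e ** a = a /\ a ** e = a.

Definition cstar_pos (R : realType) (A : cstarAlgType R) (a : A) : Prop :=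
  exists x : A, a = star x ** x.

Definition complete_for (R : realType) (E : lmodType R[i]) (N : E -> R[i]) :=
  forall u : nat -> E,
    (forall e : R[i], 0 < e -> exists k : nat, forall p q : nat,
        (k <= p)%N -> (k <= q)%N -> N (u p - u q) < e) ->
    exists l : E, forall e : R[i], 0 < e -> exists k : nat, forall p : nat,
        (k <= p)%N -> N (u p - l) < e.

(* The scalar action on [E] is the one of [lmodType]; the actions of the
   C*-algebras are explicit functions, since MathComp infers a single scaling
   structure per carrier. *)
Record leftHilbertModule (R : realType) (A : cstarAlgType R)
    (E : lmodType R[i]) := LeftHilbertModule {
  lact : A -> E -> E ;
  lip : E -> E -> A ;
  lactDl : forall a b f, lact (a + b) f = lact a f + lact b f ;
  lactDr : forall a f g, lact a (f + g) = lact a f + lact a g ;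
  lactA : forall a b f, lact a (lact b f) = lact (a ** b) f ;
  lactZl : forall (c : R[i]) a f, lact (c *: a) f = c *: lact a f ;
  lactZr : forall (c : R[i]) a f, lact a (c *: f) = c *: lact a f ;
  lipD : forall f g h, lip (f + g) h = lip f h + lip g h ;
  lipZ : forall (c : R[i]) f g, lip (c *: f) g = c *: lip f g ;
  lip_act : forall a f g, lip (lact a f) g = a ** lip f g ;
  lip_star : forall f g, star (lip f g) = lip g f ;
  lip_pos : forall f, cstar_pos (lip f f) ;
  lip_def : forall f, lip f f = 0 -> f = 0 ;
  lip_complete : complete_for (fun f => sqrtC `|lip f f|)
}.

Record rightHilbertModule (R : realType) (B : cstarAlgType R)
    (E : lmodType R[i]) := RightHilbertModule {
  ract : E -> B -> E ;
  rip : E -> E -> B ;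
  ractDl : forall f g b, ract (f + g) b = ract f b + ract g b ;
  ractDr : forall f a b, ract f (a + b) = ract f a + ract f b ;
  ractA : forall f a b, ract (ract f a) b = ract f (a ** b) ;
  ractZl : forall (c : R[i]) f b, ract (c *: f) b = c *: ract f b ;
  ractZr : forall (c : R[i]) f b, ract f (c *: b) = c *: ract f b ;
  ripD : forall f g h, rip f (g + h) = rip f g + rip f h ;
  ripZ : forall (c : R[i]) f g, rip f (c *: g) = c *: rip f g ;
  rip_act : forall f g b, rip f (ract g b) = rip f g ** b ;
  rip_star : forall f g, star (rip f g) = rip g f ;
  rip_pos : forall f, cstar_pos (rip f f) ;
  rip_def : forall f, rip f f = 0 -> f = 0 ;
  rip_complete : complete_for (fun f => sqrtC `|rip f f|)
}.

Definition ip_span (R : realType) (A : cstarAlgType R) (E : Type)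
    (ip : E -> E -> A) : set A :=
  [set a | exists (m : nat) (c : 'I_m -> R[i]) (f g : 'I_m -> E),
             a = \sum_(k < m) c k *: ip (f k) (g k)].

Record equivalenceBimodule (R : realType) (A B : cstarAlgType R)
    (E : lmodType R[i]) := EquivalenceBimodule {
  eb_left :> leftHilbertModule A E ;
  eb_right :> rightHilbertModule B E ;
  eb_assoc : forall a f b,
    ract eb_right (lact eb_left a f) b = lact eb_left a (ract eb_right f b) ;
  eb_lfull : dense (ip_span (lip eb_left)) ;
  eb_rfull : dense (ip_span (rip eb_right)) ;
  eb_ladj : forall a f g,
    rip eb_right (lact eb_left a f) g = rip eb_right f (lact eb_left (star a) g) ;
  eb_radj : forall f g b,
    lip eb_left (ract eb_right f b) g = lip eb_left f (ract eb_right g (star b)) ;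
  eb_imprimitivity : forall f g h,
    lact eb_left (lip eb_left f g) h = ract eb_right f (rip eb_right g h)
}.

(* A finite trace, extended from the positive cone to a linear functional. *)
Record finite_trace (R : realType) (A : cstarAlgType R)
    (tr : {scalar A}) : Prop := FiniteTrace {
  trace_pos : forall a : A, cstar_pos a -> 0 <= tr a ;
  traceC : forall a b : A, tr (a ** b) = tr (b ** a)
}.

Definition faithful (R : realType) (A : cstarAlgType R)
    (tr : {scalar A}) : Prop :=
  forall a : A, cstar_pos a -> tr a = 0 -> a = 0.

Definition lsc_on_cone (R : realType) (A : cstarAlgType R)
    (tr : {scalar A}) : Prop :=
  forall (a : A) (t : R[i]), cstar_pos a -> t < tr a ->
    \forall x \near a, cstar_pos x -> t < tr x.

Record rightGaborBimodule (R : realType) (A B : cstarAlgType R)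
    (E : lmodType R[i]) := RightGaborBimodule {
  rgb_bimodule :> equivalenceBimodule A B E ;
  rgb_one : A ;
  rgb_oneP : is_unit_element rgb_one ;
  rgb_trace : {scalar A} ;
  rgb_finite_trace : finite_trace rgb_trace ;
  rgb_faithful : faithful rgb_trace
}.

(* Meant for unital [B]: the induced lower semicontinuous trace is then finite,
   hence given by a linear functional. *)
Record induced_trace (R : realType) (A B : cstarAlgType R)
    (E : lmodType R[i]) (G : rightGaborBimodule A B E)
    (trB : {scalar B}) : Prop := InducedTrace {
  induced_finite_trace : finite_trace trB ;
  induced_lsc : lsc_on_cone trB ;
  induced_compat : forall f g : E, rgb_trace G (lip G f g) = trB (rip G g f)
}.

Section MatrixModule.
Variables (R : realType) (A B : cstarAlgType R) (E : lmodType R[i]).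
Variables (G : equivalenceBimodule A B E) (n d : nat).

Definition mx_lact (a : 'M[A]_n) (f : 'M[E]_(n, d)) : 'M[E]_(n, d) :=
  \matrix_(i, j) \sum_k lact G (a i k) (f k j).

Definition mx_lip (f g : 'M[E]_(n, d)) : 'M[A]_n :=
  \matrix_(i, j) \sum_k lip G (f i k) (g j k).

Definition Phi (g f : 'M[E]_(n, d)) : 'M[A]_n := mx_lip f g.

Definition Phi_adj (g : 'M[E]_(n, d)) (a : 'M[A]_n) : 'M[E]_(n, d) :=
  mx_lact a g.

End MatrixModule.

Definition mx_cmul (R : realType) (A : cstarAlgType R) (n : nat)
    (a b : 'M[A]_n) : 'M[A]_n :=
  \matrix_(i, j) \sum_k a i k ** b k j.

(* An isomorphism of left modules over the matrix algebra. For the maps at hand,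
   boundedness of the inverse is automatic. *)
Definition mx_module_iso (R : realType) (A : cstarAlgType R) (n : nat)
    (T : 'M[A]_n -> 'M[A]_n) : Prop :=
  [/\ {morph T : x y / x + y},
      forall a x : 'M[A]_n, T (mx_cmul a x) = mx_cmul a (T x)
    & bijective T].

(* Main.v *)
Require Import Defs.
From mathcomp Require Import all_boot all_order all_algebra.
From mathcomp Require Import complex.
From mathcomp Require Import reals.

Set Implicit Arguments.
Unset Strict Implicit.
Unset Printing Implicit Defensive.

Import Order.TTheory GRing.Theory Num.Theory.

Local Open Scope ring_scope.

(** Write [S = [g, g]] in [M_n(A)].  Since [Phi_g Phi_g^*] is the map
    [a |-> a S], its bijectivity makes [S] invertible; let [h = S^-1 g] be the
    canonical dual of [g], so that [[h, g] = 1] in [M_n(A)] and [S h = g].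
    By the imprimitivity identity the matrix [P = [g, h]] of [M_d(B)], formally
    [g^* S^-1 g], is a projection.  The traces see the same number on both
    sides: [Tr tr_B P = Tr tr_A [h, g] = n tr_A(1)], while a projection of
    [M_d(B)] has trace at most [d tr_B(1)].

    The dual [h] plays here the role of the Parseval element [S^(-1/2) g]: the
    non-symmetric pairing [[g, h]] already gives the projection onto the range
    of the frame transform.  That [P] is a projection enters through
    [P^* P = P^*], read on the diagonal ([rip_dual_column]): it exhibits
    [1 - P_ii] as a sum of elements [x^* x] ([trace_le_one]), which the
    positive functional [tr_B] sends to a nonnegative number. *)

Lemma morphD_sum (U V : zmodType) (f : U -> V) (fD : {morph f : x y / x + y})
    (I : finType) (F : I -> U) :
  f (\sum_i F i) = \sum_i f (F i).
Proof.
apply: (big_morph f fD).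
by apply: (@addrI _ (f 0)); rewrite -fD !addr0.
Qed.

Lemma morphD_opp (U V : zmodType) (f : U -> V) (fD : {morph f : x y / x + y})
    (x : U) :
  f (- x) = - f x.
Proof.
have f0 : f 0 = 0 by apply: (@addrI _ (f 0)); rewrite -fD !addr0.
by apply/eqP; rewrite -addr_eq0 -fD addNr f0.
Qed.

Section StarAlgebra.
Variables (R : realType) (B : cstarAlgType R).

Lemma star_one (e : B) : is_unit_element e -> star e = e.
Proof.
by move=> he; rewrite -[LHS](he _).2 -{2}[e]starK -starM (he _).2 starK.
Qed.

Lemma cmul0 (a : B) : a ** 0 = 0.
Proof. by apply: (@addrI _ (a ** 0)); rewrite -cmulDr !addr0. Qed.

(** The hypothesis is the [(i, i)] entry of [P^* P = P^*] when [b] is the [i]-th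
    column of [P]; the [(i, i)] entry of [(1 - P)^* (1 - P)] is then
    [1 - b i], visibly a sum of positive elements. *)
Lemma trace_le_one (tr : {scalar B}) (e : B) (I : finType) (b : I -> B)
    (i : I) :
  finite_trace tr -> is_unit_element e ->
  \sum_k star (b k) ** b k = star (b i) ->
  tr (b i) <= tr e.
Proof.
move=> htr he hb; rewrite -subr_ge0 -raddfB.
have -> : e - b i = star (e - b i) ** (e - b i)
                    + \sum_(k | k != i) star (b k) ** b k.
  have := hb; rewrite (bigD1 i) //= => /(canRL (addKr _)) ->.
  have sN := morphD_opp (@starD _ B).
  rewrite starD sN (star_one he) cmulDl (he _).1.
  have -> : - star (b i) ** (e - b i) = - star (b i) + star (b i) ** b i.
    have mN := morphD_opp (fun x y => @cmulDl _ B x y (e - b i)).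
    rewrite mN cmulDr (he _).2 (morphD_opp (@cmulDr _ B (star (b i)))).
    by rewrite opprD opprK.
  by rewrite -!addrA [star (b i) ** b i + _]addrA subrr add0r addNr addr0.
rewrite raddfD raddf_sum /= addr_ge0 ?sumr_ge0 // => [|k _];
  by apply: (trace_pos htr); eexists.
Qed.

End StarAlgebra.

(** The unit of [M_n(A)] depends on a chosen [e : A] because the unit of [A] is
    a property of an element and not part of the algebra structure. *)
Definition mx_one (R : realType) (A : cstarAlgType R) (n : nat) (e : A) :
    'M[A]_n :=
  \matrix_(i, j) if i == j then e else 0.

Lemma mx_cmul1 (R : realType) (A : cstarAlgType R) (n : nat) (e : A)
    (a : 'M[A]_n) :
  is_unit_element e -> mx_cmul a (mx_one n e) = a.
Proof.
move=> he; apply/matrixP => i j; rewrite mxE (bigD1 j) //= big1 => [|k kj].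
  by rewrite mxE eqxx (he _).2 addr0.
by rewrite mxE (negPf kj) cmul0.
Qed.

Section Bimodule.
Variables (R : realType) (A B : cstarAlgType R) (E : lmodType R[i]).
Variable G : equivalenceBimodule A B E.

Let lactDl' f : {morph (fun a => lact G a f) : a b / a + b}.
Proof. by move=> a b; apply: lactDl. Qed.

Let lactDr' a : {morph lact G a : f g / f + g}.
Proof. by move=> f g; apply: lactDr. Qed.

Let ripDr' f : {morph rip G f : g h / g + h}.
Proof. by move=> g h; apply: ripD. Qed.

(** The action is automatically unital: [1 f - f] has zero inner product with
    everything, in particular with itself. *)
Lemma lact1 (e : A) (f : E) : is_unit_element e -> lact G e f = f.
Proof.
move=> he; apply/eqP; rewrite -subr_eq0; apply/eqP/(lip_def (l := G)).
rewrite lipD lip_act (he _).1 -lipD subrr.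
by apply: (@addrI _ (lip G 0 (lact G e f - f))); rewrite -lipD !addr0.
Qed.

Variables n d : nat.
Implicit Types (a b : 'M[A]_n) (f g h : 'M[E]_(n, d)).

Lemma mx_lact1 (e : A) f :
  is_unit_element e -> mx_lact G (mx_one n e) f = f.
Proof.
move=> he; apply/matrixP => i j; rewrite mxE (bigD1 i) //= big1 => [|k ki].
  by rewrite mxE eqxx lact1 // addr0.
rewrite mxE eq_sym (negPf ki).
by apply: (@addrI _ (lact G 0 (f k j))); rewrite -lactDl !addr0.
Qed.

Lemma mx_lactA a b f :
  mx_lact G a (mx_lact G b f) = mx_lact G (mx_cmul a b) f.
Proof.
apply/matrixP => i j; rewrite !mxE.
under eq_bigr => k _ do rewrite mxE (morphD_sum (lactDr' _)).
rewrite exchange_big; apply: eq_bigr => l _ /=.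
rewrite mxE (morphD_sum (lactDl' _)).
by apply: eq_bigr => k _; rewrite lactA.
Qed.

(** With [P k i = [g, h] k i], this is the [(i, i)] entry of
    [P^* P = h^* g g^* h = h^* S h = h^* g = P^*], where regrouping
    [g (g^* h)] as [(g g^* ) h] is the imprimitivity identity. *)
Lemma rip_dual_column g h :
  mx_lact G (mx_lip G g g) h = g ->
  let P k i := \sum_m rip G (g m k) (h m i) in
  forall i, \sum_k star (P k i) ** P k i = star (P i i).
Proof.
move=> Sh P i.
have starP k : star (P k i) = \sum_m rip G (h m i) (g m k).
  rewrite /P (morphD_sum (@starD _ B)).
  by apply: eq_bigr => m _; rewrite rip_star.
rewrite starP.
under eq_bigr => k _.
  rewrite starP (morphD_sum (fun x y => @cmulDl _ B x y _)).
  over.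
rewrite exchange_big; apply: eq_bigr => m _ /=.
rewrite -{2}Sh mxE (morphD_sum (ripDr' _)).
under eq_bigr => k _ do rewrite (morphD_sum (@cmulDr _ B _)).
rewrite exchange_big; apply: eq_bigr => l _ /=.
rewrite mxE (morphD_sum (lactDl' _)) (morphD_sum (ripDr' _)).
by apply: eq_bigr => k _; rewrite eb_imprimitivity rip_act.
Qed.

(** The witness is [h = s g] with [s] the preimage of [1] under
    [T = Phi_g Phi_g^*].  Thus [s S = 1] by choice, and [S s = 1] because [T]
    is injective and [M_n(A)]-linear: [T (S s) = S (T s) = S = T 1]. *)
Lemma dual_frame (e : A) g :
  is_unit_element e -> mx_module_iso (Phi G g \o Phi_adj G g) ->
  exists h, mx_lip G h g = mx_one n e
            /\ mx_lact G (mx_lip G g g) h = g.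
Proof.
move=> he [_ Tlin Tbij]; have [T' _ T'K] := Tbij.
pose s := T' (mx_one n e).
have Ts : (Phi G g \o Phi_adj G g) s = mx_one n e by apply: T'K.
exists (mx_lact G s g); split; first exact: Ts.
suff Ss : mx_cmul (mx_lip G g g) s = mx_one n e.
  by rewrite mx_lactA Ss mx_lact1.
apply: (bij_inj Tbij); rewrite Tlin Ts mx_cmul1 //=.
by rewrite /Phi_adj mx_lact1.
Qed.

End Bimodule.

Theorem theorem3p29 (R : realType) (n d : nat) (hn : (0 < n)%N) (hd : (0 < d)%N)
  (A B : cstarAlgType R) (E : lmodType R[i])
  (G : rightGaborBimodule A B E)
  (oneB : B) (hB : is_unit_element oneB)
  (trB : {scalar B}) (htrB : induced_trace G trB)
  (g : 'M[E]_(n, d))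
  (hg : mx_module_iso (Phi G g \o Phi_adj G g)) :
  d%:R * trB oneB >= n%:R * rgb_trace G (rgb_one G).
Proof.
have [h [hg1 Sh]] := dual_frame (rgb_oneP G) hg.
have diagP i : trB (\sum_m rip G (g m i) (h m i)) <= trB oneB.
  apply: (@trace_le_one _ _ _ _ _ (fun k => \sum_m rip G (g m k) (h m i))
            i (induced_finite_trace htrB) hB).
  exact: rip_dual_column Sh i.
(* Trace compatibility: [Tr tr_B [g, h] = Tr tr_A [h, g]], and [[h, g] = 1]. *)
have -> : n%:R * rgb_trace G (rgb_one G)
          = \sum_(i < d) trB (\sum_m rip G (g m i) (h m i)).
  under eq_bigr => i _ do rewrite raddf_sum.
  rewrite exchange_big mulr_natl -[n in LHS]card_ord -sumr_const.
  apply: eq_bigr => m _ /=.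
  have := congr1 (fun M : 'M[A]_n => M m m) hg1; rewrite !mxE eqxx => <-.
  by rewrite raddf_sum; apply: eq_bigr => i _; rewrite /= (induced_compat htrB).
have -> : d%:R * trB oneB = \sum_(i < d) trB oneB.
  by rewrite sumr_const card_ord mulr_natl.
by apply: ler_sum => i _.
Qed.
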